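(* Let $X$ and $Y$ be disjoint finite sets, let $\mu$ and $\nu$ be probability distributions on $X$ and $Y$ respectively giving positive mass to every element, and let $S \subseteq X \times Y$. Then the system $\langle X,Y,\mu,\nu,S\rangle$ is expansive if and only if it is solvable.
   Context: For $U \subseteq X$ write $|U| := \mu(U)$ and for $V\subseteq Y$ write $|V| := \nu(V)$. For $U \subseteq X$ put $N(U) := \{y \in Y : (x,y)\in S \text{ for some } x \in U\}$, and for $V \subseteq Y$ put $N(V) := \{x \in X : (x,y) \in S \text{ for some } y \in V\}$. A set $U\subseteq X$ is expansive if either $|N(U)| > |U|$, or $|N(U)| = |U| = |N(N(U))|$. The system is expansive if every $U \subseteq X$ is expansive. The system is solvable if there is a probability distribution $\gamma$ on $X\times Y$ with $X$-marginal $\mu$ and $Y$-marginal $\nu$ whose support is exactly $S$, i.e. $\gamma(\{(x,y)\})>0$ if and only if $(x,y)\in S$. *)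

(* Defs.v *)
From HB Require Import structures.
From mathcomp Require Import all_boot all_order all_algebra.
From mathcomp Require Import reals.

Set Implicit Arguments.
Unset Strict Implicit.
Unset Printing Implicit Defensive.

Import Order.TTheory GRing.Theory Num.Theory.
Local Open Scope ring_scope.

Definition prob_distr (R : realType) (T : finType) (p : T -> R) : Prop :=
  (forall t, 0 <= p t) /\ \sum_t p t = 1.

(* Written |U| := mu(U) in mathematical notation; not to be confused with the cardinal #|U|. *)
Definition mass (R : realType) (T : finType) (p : T -> R) (U : {set T}) : R :=
  \sum_(t in U) p t.

(* X and Y are distinct carrier types, hence disjoint, so the overloaded N(_)
   splits into NX : subsets of X -> subsets of Y, and NY the other way. *)
Definition NX (X Y : finType) (S : {set X * Y}) (U : {set X}) : {set Y} :=
  [set y : Y | [exists x in U, (x, y) \in S]].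

Definition NY (X Y : finType) (S : {set X * Y}) (V : {set Y}) : {set X} :=
  [set x : X | [exists y in V, (x, y) \in S]].

Definition expansive_set (R : realType) (X Y : finType)
    (mu : X -> R) (nu : Y -> R) (S : {set X * Y}) (U : {set X}) : Prop :=
  mass mu U < mass nu (NX S U) \/
  (mass nu (NX S U) = mass mu U /\ mass mu U = mass mu (NY S (NX S U))).

Definition expansive (R : realType) (X Y : finType)
    (mu : X -> R) (nu : Y -> R) (S : {set X * Y}) : Prop :=
  forall U : {set X}, expansive_set mu nu S U.

Definition solvable_system (R : realType) (X Y : finType)
    (mu : X -> R) (nu : Y -> R) (S : {set X * Y}) : Prop :=
  exists gamma : X * Y -> R,
    [/\ prob_distr gamma,
        (forall x, \sum_(y : Y) gamma (x, y) = mu x),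
        (forall y, \sum_(x : X) gamma (x, y) = nu y) &
        (forall x y, 0 < gamma (x, y) <-> (x, y) \in S)].

(* Main.v *)
(** Subtracting a small multiple [e] of the indicator of [S] reduces expansive ->
    solvable to the fractional Hall theorem: Hall's condition survives at sets
    [U] with [|N(U)| > |U|] because [e] is small, and at tight sets because
    [N(N(U)) = U] means that no edge enters [N(U)] from outside [U].

    The fractional Hall theorem is proved by induction on [S]. To delete an edge
    [(x, y)], send along it the worst deficiency [t] of Hall's condition in the
    graph without that edge; Hall's condition is then restored at all sets
    deficient there, and submodularity of [U |-> |N(U)|] shows that no other set
    is violated. *)
Require Import Defs.
From HB Require Import structures.
From mathcomp Require Import all_boot all_order all_algebra.
From mathcomp Require Import reals lra.

Set Implicit Arguments.
Unset Strict Implicit.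
Unset Printing Implicit Defensive.

Import Order.TTheory GRing.Theory Num.Theory.
Local Open Scope ring_scope.

(** * Masses of subsets of a finite set *)

Section Mass.
Variables (R : realType) (T : finType).
Implicit Types (p : T -> R) (A B : {set T}).

Lemma mass_ge0 p A : (forall t, 0 <= p t) -> 0 <= mass p A.
Proof. by move=> p0; apply: sumr_ge0. Qed.

Lemma mass_indic p A : mass p A = \sum_t p t *+ (t \in A).
Proof. by rewrite /mass big_mkcond; apply: eq_bigr => t _; case: ifP. Qed.

Lemma le_mass p A B : (forall t, 0 <= p t) -> A \subset B -> mass p A <= mass p B.
Proof.
move=> p0 /subsetP AB; rewrite !mass_indic; apply: ler_sum => t _.
have := AB t; case: (t \in A) => [->//|_].
by rewrite mulr0n mulrn_wge0.
Qed.

Lemma massUI p A B : mass p (A :|: B) + mass p (A :&: B) = mass p A + mass p B.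
Proof.
rewrite !mass_indic -!big_split; apply: eq_bigr => t _ /=.
by rewrite !inE; case: (t \in A); case: (t \in B); rewrite /= ?addr0 ?add0r.
Qed.

Lemma mass_sub_point p t0 c A :
  mass (fun t => p t - c *+ (t == t0)) A = mass p A - c *+ (t0 \in A).
Proof.
rewrite /mass sumrB; congr (_ - _); rewrite big_mkcond (bigD1 t0)//= eqxx.
by rewrite big1 ?addr0; [case: ifP | move=> t /negPf->; rewrite if_same].
Qed.

Lemma mass_set1 p t : mass p [set t] = p t.
Proof. by rewrite /mass big_set1. Qed.

Lemma mass_setT p : mass p setT = \sum_t p t.
Proof. by rewrite /mass; apply: eq_bigl => t; rewrite inE. Qed.

Lemma mass0 p : mass p set0 = 0.
Proof. by rewrite /mass big_set0. Qed.

Lemma eq_mass_subset p A B : (forall t, 0 < p t) -> A \subset B ->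
  mass p A = mass p B -> A = B.
Proof.
move=> p0 AB e; apply/eqP; rewrite eqEsubset AB; apply/subsetP => t tB.
apply: contraTT isT => tA.
have := le_mass (fun u => ltW (p0 u)) (_ : t |: A \subset B).
rewrite subUset sub1set tB AB => /(_ isT).
have := massUI p [set t] A.
have -> : [set t] :&: A = set0.
  by apply/setP => u; rewrite !inE; case: eqP => // ->; apply/negbTE.
by rewrite mass0 mass_set1; have := p0 t; lra.
Qed.

(** The least positive value works; the default [1] of the minimum covers an [f] with no positive
    value. *)
Lemma finite_pos_lower_bound (f : T -> R) :
  exists2 e, 0 < e & forall t, 0 < f t -> e <= f t.
Proof.
exists (\big[Num.min/1]_(t | 0 < f t) f t).
  by apply: lt_bigmin => [|t]; first exact: ltr01.
by move=> t ft; apply: bigmin_le_cond.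
Qed.

End Mass.

(** * Neighbourhoods in a bipartite graph, and the effect of deleting an edge *)

Section Neighbours.
Variables X Y : finType.
Implicit Types (S : {set X * Y}) (U W : {set X}) (V : {set Y}).

Lemma NXP S U y : reflect (exists2 x, x \in U & (x, y) \in S) (y \in NX S U).
Proof. by rewrite inE; apply: exists_inP. Qed.

Lemma NYP S V x : reflect (exists2 y, y \in V & (x, y) \in S) (x \in NY S V).
Proof. by rewrite inE; apply: exists_inP. Qed.

Lemma NX0 S : NX S set0 = set0.
Proof. by apply/setP => y; rewrite !inE; apply/exists_inP => -[x]; rewrite inE. Qed.

Lemma NXS S U W : U \subset W -> NX S U \subset NX S W.
Proof.
move=> /subsetP UW; apply/subsetP => y /NXP[x xU xy].
by apply/NXP; exists x => //; apply: UW.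
Qed.

Lemma NX_graphS S S' U : S \subset S' -> NX S U \subset NX S' U.
Proof.
move=> /subsetP SS'; apply/subsetP => y /NXP[x xU xy].
by apply/NXP; exists x => //; apply: SS'.
Qed.

Lemma NXU S U W : NX S (U :|: W) = NX S U :|: NX S W.
Proof.
apply/eqP; rewrite eqEsubset subUset.
rewrite (NXS _ (subsetUl _ _)) (NXS _ (subsetUr _ _)) !andbT.
apply/subsetP => y /NXP[x]; rewrite !inE => /orP[] xU xy.
  by apply/orP; left; apply/exists_inP; exists x.
by apply/orP; right; apply/exists_inP; exists x.
Qed.

Lemma NX_setD1 S x y U :
  NX S U \subset y |: NX (S :\ (x, y)) U.
Proof.
apply/subsetP => z /NXP[u uU uz]; rewrite in_setU1; case: eqVneq => //= zy.
by apply/NXP; exists u => //; rewrite !inE uz xpair_eqE (negPf zy) andbF.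
Qed.

Lemma NX_setD1_notin S x y U : x \notin U -> NX (S :\ (x, y)) U = NX S U.
Proof.
move=> xU; apply/eqP; rewrite eqEsubset NX_graphS ?subsetDl//=.
apply/subsetP => z /NXP[u uU uz]; apply/NXP; exists u => //.
by rewrite !inE uz xpair_eqE; case: eqVneq uU xU => //= -> ->.
Qed.

Lemma NX_setD1_in S x y U :
  y \in NX (S :\ (x, y)) U -> NX (S :\ (x, y)) U = NX S U.
Proof.
move=> yN; apply/eqP; rewrite eqEsubset NX_graphS ?subsetDl//=.
by apply: subset_trans (NX_setD1 S x y U) _; rewrite subUset sub1set yN /=.
Qed.

Lemma sub_NYNX S U :
  (forall x, x \in U -> exists y, (x, y) \in S) -> U \subset NY S (NX S U).
Proof.
move=> nb; apply/subsetP => x xU; have [y xy] := nb x xU.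
by apply/NYP; exists y => //; apply/NXP; exists x.
Qed.

End Neighbours.

(** * The fractional Hall theorem *)

Section FractionalHall.
Variables (R : realType) (X Y : finType).

Definition hall (mu : X -> R) (nu : Y -> R) (S : {set X * Y}) : Prop :=
  forall U, mass mu U <= mass nu (NX S U).

Lemma hall_setD1 (mu : X -> R) (nu : Y -> R) (S : {set X * Y}) x y :
  (forall z, 0 <= nu z) -> (x, y) \in S -> hall mu nu S ->
  exists t, [/\ 0 <= t, t <= nu y &
    hall (fun u => mu u - t *+ (u == x)) (fun z => nu z - t *+ (z == y))
         (S :\ (x, y))].
Proof.
move=> nu0 xyS H; set S' := S :\ (x, y).
(* [d U] is the deficiency of [U] once the edge is gone. The empty set has deficiency zero, so the
   maximum [d A] is nonnegative. *)
pose d U := mass mu U - mass nu (NX S' U).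
have [A _ Amax] := @arg_maxP _ _ _ set0 xpredT d isT.
have dle U : d U <= d A by apply: Amax.
have dA0 : 0 <= d A.
  by apply: le_trans (dle set0); rewrite /d NX0 !mass0 subr0.
(* Only a set that loses the neighbour [y] with the edge can be deficient. *)
have good (U : {set X}) : x \notin U \/ y \in NX S' U -> d U <= 0.
  rewrite /d subr_le0 /S'.
  by case=> [/NX_setD1_notin-> | /NX_setD1_in->]; apply: H.
have no_deficiency : d A <= 0 -> exists t, [/\ 0 <= t, t <= nu y &
    hall (fun u => mu u - t *+ (u == x)) (fun z => nu z - t *+ (z == y)) S'].
  move=> dA; exists 0; split => // U; rewrite !mass_sub_point !mul0rn !subr0.
  by rewrite -subr_le0; apply: le_trans dA; apply: dle.
have [xA|/(fun h => good A (or_introl h)) dA] := boolP (x \in A); last first.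
  exact: no_deficiency.
have [/(fun h => good A (or_intror h)) dA|yA] := boolP (y \in NX S' A).
  exact: no_deficiency.
exists (d A); split => //.
  (* Deleting the edge removes at most [y] from the neighbourhood of [A], so the deficiency created
     is at most [nu y]. *)
  have := le_mass nu0 (NX_setD1 S x y A); have := H A.
  have := massUI nu [set y] (NX S' A); rewrite mass_set1 -/S'.
  have := mass_ge0 ([set y] :&: NX S' A) nu0; rewrite /d; lra.
move=> V; rewrite !mass_sub_point.
have dV : d V = mass mu V - mass nu (NX S' V) by [].
have := dle V; have := @good V.
(* If both sides lose [d A], or neither does, [good] suffices; if only the left one does, maximality
   of [d A] suffices. The remaining case needs uncrossing. *)
case xV : (x \in V); case yV : (y \in NX S' V) => /=; rewrite ?mulr1n ?mulr0n.
- by move=> /(_ (or_intror isT)); lra.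
- by lra.
(* Uncrossing of [A] and [V]: as [y] is already a neighbour of [V], the union gains nothing from the
   deleted edge, and the intersection misses [x]. Hall's condition in [S] at both sets then leaves
   room [d A] at [V]. *)
- move=> _ _; rewrite /S' NX_setD1_notin ?xV//.
  have yN : y \in NX S V by rewrite -(@NX_setD1_notin _ _ S x y) ?xV.
  have hU := H (A :|: V); have hI := H (A :&: V).
  have lU : mass nu (NX S (A :|: V)) <= mass nu (NX S' A :|: NX S V).
    apply: le_mass => //; rewrite NXU subUset subsetUr andbT.
    apply: subset_trans (NX_setD1 S x y A) _.
    by rewrite subUset sub1set !in_setU yN orbT subsetUl.
  have lI : mass nu (NX S (A :&: V)) <= mass nu (NX S' A :&: NX S V).
    apply: le_mass => //; rewrite subsetI NXS ?subsetIr// andbT.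
    rewrite -(@NX_setD1_notin _ _ S x y); last by rewrite inE xV andbF.
    by apply: NXS; apply: subsetIl.
  have := massUI mu A V; have := massUI nu (NX S' A) (NX S V).
  rewrite /d; lra.
- by move=> /(_ (or_introl isT)); lra.
Qed.

(** Equality of the totals survives each deletion and makes both marginals exact at the end. *)
Theorem fractional_hall (mu : X -> R) (nu : Y -> R) (S : {set X * Y}) :
  (forall y, 0 <= nu y) -> \sum_x mu x = \sum_y nu y -> hall mu nu S ->
  exists g : X -> Y -> R,
    [/\ forall x y, 0 <= g x y, forall x y, (x, y) \notin S -> g x y = 0,
        forall x, \sum_y g x y = mu x & forall y, \sum_x g x y = nu y].
Proof.
have [n] := ubnP #|S|; elim: n => // n IH in mu nu S *.
rewrite ltnS => Sn nu0 eqs H.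
have [S0|[[x0 y0] xyS]] := set_0Vmem S.
  (* Without edges, Hall's condition makes [mu] nonpositive, while its total equals that of the
     nonnegative [nu]; hence both vanish. *)
  have mu_le0 x : mu x <= 0.
    have := H [set x]; rewrite mass_set1 (_ : NX S _ = set0) ?mass0//.
    by apply/setP => y; rewrite in_set0; apply/NXP => -[u _]; rewrite S0 inE.
  have sum0 : \sum_x mu x = 0.
    by apply/eqP; rewrite eq_le {2}eqs sumr_le0 ?sumr_ge0.
  exists (fun _ _ => 0); split => //.
    move=> x; rewrite big1//; apply/esym/eqP; rewrite -oppr_eq0.
    have/psumr_eq0P : \sum_x - mu x = 0 by rewrite sumrN sum0 oppr0.
    by move=> ->//= u _; rewrite oppr_ge0.
  by move=> y; rewrite big1//; move: sum0; rewrite eqs => /psumr_eq0P->.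
have [t [t0 ty H']] := hall_setD1 nu0 xyS H.
case: (IH _ _ _ _ _ _ H') => [|z||g [g0 gS gX gY]].
- by apply: leq_trans Sn; rewrite [in leqRHS](cardsD1 (x0, y0)) xyS.
- by rewrite subr_ge0; case: eqP => [->|]; rewrite ?mulr1n ?mulr0n.
- by rewrite -2!mass_setT !mass_sub_point !mass_setT !inE eqs.
exists (fun x y => g x y + t *+ ((x, y) == (x0, y0))); split.
- by move=> x y; rewrite addr_ge0 ?mulrn_wge0.
- move=> x y xy; rewrite gS ?inE ?negb_and ?xy ?orbT//.
  by case: eqP xy => [->|]; rewrite ?xyS// mulr0n addr0.
- move=> x; rewrite big_split gX /= (bigD1 y0)//= big1 => [|y /negPf y0y].
    by rewrite xpair_eqE eqxx andbT addr0 subrK.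
  by rewrite xpair_eqE y0y andbF.
- move=> y; rewrite big_split gY /= (bigD1 x0)//= big1 => [|x /negPf x0x].
    by rewrite xpair_eqE eqxx addr0 subrK.
  by rewrite xpair_eqE x0x.
Qed.

End FractionalHall.

(** * Double counting of a weight supported on the edges *)

Section Support.
Variables (R : realType) (X Y : finType) (S : {set X * Y}) (g : X -> Y -> R).
Hypothesis g_supp : forall x y, (x, y) \notin S -> g x y = 0.
Implicit Types U : {set X}.

(** All the weight in the rows of [U] lies in the columns of [NX S U]. *)
Lemma sum_NX U :
  \sum_(x in U) \sum_y g x y = \sum_(y in NX S U) \sum_(x in U) g x y.
Proof.
rewrite [RHS]exchange_big /=; apply: eq_bigr => x xU.
rewrite [LHS](bigID (mem (NX S U))) /= [X in _ + X]big1 ?addr0// => y yN.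
by apply: g_supp; apply: contraNN yN => xy; apply/NXP; exists x.
Qed.

Lemma sum_NX_closed U : NY S (NX S U) \subset U ->
  \sum_(y in NX S U) \sum_x g x y = \sum_(y in NX S U) \sum_(x in U) g x y.
Proof.
move=> /subsetP NU; apply: eq_bigr => y yN.
rewrite [LHS](bigID (mem U)) /= [X in _ + X]big1 ?addr0// => x xU.
by apply: g_supp; apply: contraNN xU => xy; apply: NU; apply/NYP; exists y.
Qed.

(** An edge entering [NX S U] from outside [U] carries positive weight that only the right-hand sum
    counts. *)
Lemma sum_NX_gt U : (forall x y, 0 <= g x y) ->
  (forall x y, (x, y) \in S -> 0 < g x y) -> ~~ (NY S (NX S U) \subset U) ->
  \sum_(y in NX S U) \sum_(x in U) g x y < \sum_(y in NX S U) \sum_x g x y.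
Proof.
move=> g0 gpos /subsetPn[x /NYP[y yN xy] xU].
have le z : \sum_(x in U) g x z <= \sum_x g x z.
  by rewrite [leRHS](bigID (mem U)) /= lerDl sumr_ge0.
rewrite (bigD1 y)//= [ltRHS](bigD1 y)//= ltr_leD//; last exact: ler_sum.
rewrite [ltRHS](bigID (mem U)) /= ltrDl (bigD1 x)//= ltr_wpDr ?sumr_ge0//.
exact: gpos.
Qed.

End Support.

(** * The two implications *)

Lemma solvable_expansive (R : realType) (X Y : finType)
    (mu : X -> R) (nu : Y -> R) (S : {set X * Y}) :
  (forall x, 0 < mu x) -> solvable_system mu nu S -> expansive mu nu S.
Proof.
move=> mu_pos [gamma [[gamma0 _] gX gY gS]] U.
pose g x y := gamma (x, y).
have g0 x y : 0 <= g x y by apply: gamma0.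
have supp x y : (x, y) \notin S -> g x y = 0.
  move=> xy; apply/eqP; rewrite eq_le g0 andbT leNgt.
  by apply: contraNN xy => /gS.
have muE : mass mu U = \sum_(y in NX S U) \sum_(x in U) g x y.
  by rewrite -(sum_NX supp); apply: eq_bigr => x _; rewrite -gX.
have nuE : mass nu (NX S U) = \sum_(y in NX S U) \sum_x g x y.
  by apply: eq_bigr => y _; rewrite -gY.
have nb x : x \in U -> exists y, (x, y) \in S.
  move=> _; apply/existsP; apply: contraLR (mu_pos x) => /existsPn no.
  by rewrite -gX big1 ?ltxx// => y _; apply: supp.
(* [mass nu (NX S U)] exceeds [mass mu U] by the weight of the edges entering [NX S U] from outside
   [U], so the two alternatives of expansiveness are whether such edges exist. *)
have [NU|NU] := boolP (NY S (NX S U) \subset U); last first.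
  left; rewrite muE nuE; apply: sum_NX_gt => // x y; exact: (gS x y).2.
right; split; first by rewrite muE nuE (sum_NX_closed supp).
by congr (mass mu _); apply/eqP; rewrite eqEsubset NU sub_NYNX.
Qed.

Lemma expansive_solvable (R : realType) (X Y : finType)
    (mu : X -> R) (nu : Y -> R) (S : {set X * Y}) :
  prob_distr mu -> prob_distr nu ->
  (forall x, 0 < mu x) -> (forall y, 0 < nu y) ->
  expansive mu nu S -> solvable_system mu nu S.
Proof.
move=> [_ mu1] [_ nu1] mu_pos nu_pos E.
pose s x y : R := ((x, y) \in S)%:R.
have s0 x y : 0 <= s x y by apply: ler0n.
have s_supp x y : (x, y) \notin S -> s x y = 0 by rewrite /s => /negPf->.
have nb x : exists y, (x, y) \in S.
  have [y /NXP[u /set1P-> uy]|N0] := pickP (mem (NX S [set x])); first by exists y.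
  have := E [set x]; rewrite /expansive_set mass_set1.
  have -> : NX S [set x] = set0 by apply/setP => y; rewrite in_set0; apply: N0.
  by rewrite mass0; have mux := mu_pos x; case=> [|[]]; lra.
(* [e1] keeps [nu'] nonnegative; [e2], at most every positive surplus, keeps Hall's condition where
   it was strict. *)
have [e1 e1_gt0 e1P] := finite_pos_lower_bound nu.
have [e2 e2_gt0 e2P] :=
  finite_pos_lower_bound (fun U => mass nu (NX S U) - mass mu U).
pose C := \sum_y \sum_x s x y.
have C0 : 0 <= C by apply: sumr_ge0 => y _; apply: sumr_ge0.
(* [C] is the total mass of the indicator [s]; dividing by [C + 1] avoids a zero denominator and
   still gives [e * C <= Num.min e1 e2]. *)
pose e := Num.min e1 e2 / (C + 1).
have C1 : 0 < C + 1 by lra.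
have e_gt0 : 0 < e by rewrite divr_gt0// lt_min e1_gt0.
have eC : e * C <= Num.min e1 e2.
  have : e * (C + 1) = Num.min e1 e2 by rewrite divfK// gt_eqF.
  lra.
have eCl (V : {set Y}) : e * (\sum_(y in V) \sum_x s x y) <= Num.min e1 e2.
  apply: le_trans eC; rewrite ler_pM2l// [leRHS](bigID (mem V)) /= lerDl.
  by apply: sumr_ge0 => y _; apply: sumr_ge0.
pose mu' x := mu x - e * \sum_y s x y.
pose nu' y := nu y - e * \sum_x s x y.
have nu'0 y : 0 <= nu' y.
  rewrite subr_ge0; apply: le_trans (e1P y (nu_pos y)).
  by have := eCl [set y]; rewrite big_set1 le_min => /andP[].
have eqs : \sum_x mu' x = \sum_y nu' y.
  by rewrite !sumrB mu1 nu1 -!mulr_sumr exchange_big.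
have H : hall mu' nu' S.
  move=> U; rewrite /mass !sumrB -!mulr_sumr (sum_NX s_supp).
  have [lt|[eqN eqNN]] := E U.
    have := e2P U; rewrite subr_gt0 => /(_ lt).
    have := eCl (NX S U); rewrite le_min => /andP[_].
    have : 0 <= e * \sum_(y in NX S U) \sum_(x in U) s x y.
      by rewrite mulr_ge0 ?(ltW e_gt0)//; apply: sumr_ge0 => y _; apply: sumr_ge0.
    rewrite /mass; lra.
  (* At a tight set, equal masses and positivity of [mu] upgrade the inclusion to an equality, so
     both sides lose the same multiple of [e]. *)
  have UN : U = NY S (NX S U).
    by apply: eq_mass_subset eqNN => //; apply: sub_NYNX.
  by rewrite (sum_NX_closed s_supp) -?UN// -/(mass mu U) -/(mass nu _) eqN.
have [g [g0 gS gX gY]] := fractional_hall nu'0 eqs H.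
(* Restoring [e * s] recovers the original marginals and makes every edge strictly positive,
   whatever [g] is there. *)
pose gamma x y := g x y + e * s x y.
have gammaX x : \sum_y gamma x y = mu x.
  by rewrite big_split /= gX -mulr_sumr subrK.
have gammaY y : \sum_x gamma x y = nu y.
  by rewrite big_split /= gY -mulr_sumr subrK.
have es0 x y : 0 <= e * s x y by rewrite mulr_ge0// ltW.
exists (fun xy => gamma xy.1 xy.2); split => //.
  split=> [[x y]|]; first exact: addr_ge0.
  by rewrite -(pair_bigA _ gamma) /= (eq_bigr mu).
move=> x y /=; split=> [|xy]; last by rewrite ltr_wpDl// /s xy mulr1.
by apply: contraTT => xy; rewrite /gamma gS// s_supp// mulr0 addr0 ltxx.
Qed.

Theorem theorem4 (R : realType) (X Y : finType)
  (mu : X -> R) (nu : Y -> R) (S : {set X * Y})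
  (hmu : prob_distr mu) (hnu : prob_distr nu)
  (mu_pos : forall x : X, 0 < mu x) (nu_pos : forall y : Y, 0 < nu y) :
  expansive mu nu S <-> solvable_system mu nu S.
Proof.
split; [exact: expansive_solvable | exact: solvable_expansive].
Qed.
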